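(* Let $G$ be a finite group, $H=\mathbb{C}[G]$, and let $\mathcal{C}=\{t,x,y,z\}\subset G$ be a cyclic conjugacy class with $4$ elements, labelled so that the table of $\mathrm{Ad}$ given in the context holds. Then (depending on the group and class) either the regular connections are the solutions of the system $$\begin{aligned} A_t\wedge A_t+A_x\wedge A_y+A_y\wedge A_z+A_z\wedge A_x&=0,\\ A_t\wedge A_x+A_x\wedge A_z+A_y\wedge A_y+A_z\wedge A_t&=0,\\ A_t\wedge A_y+A_x\wedge A_t+A_y\wedge A_x+A_z\wedge A_z&=0,\\ A_t\wedge A_z+A_x\wedge A_x+A_y\wedge A_t+A_z\wedge A_y&=0, \end{aligned}$$ or the regular connections are the solutions of the system $$\begin{aligned} A_t\wedge A_t=0,\quad A_x\wedge A_x=0,\quad A_y\wedge A_y=0,\quad A_z\wedge A_z&=0,\\ A_t\wedge A_x+A_x\wedge A_z+A_z\wedge A_t&=0,\\ A_t\wedge A_y+A_x\wedge A_t+A_y\wedge A_x&=0,\\ A_t\wedge A_z+A_y\wedge A_t+A_z\wedge A_y&=0,\\ A_x\wedge A_y+A_y\wedge A_z+A_z\wedge A_x&=0. \end{aligned}$$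
   Context: Cyclic: a conjugacy class $\mathcal{C}$ with $n\ge 2$ elements in a group $G$ is called cyclic if there exists at least one $t\in\mathcal{C}$ such that $\mathrm{Ad}_t$ (where $\mathrm{Ad}_a(b)=aba^{-1}$) is a cyclic permutation of $\mathcal{C}-\{t\}$ (a single cycle on this set) and the map $a\mapsto \mathrm{Ad}_a(t)$ is a permutation of $\mathcal{C}$. For $n=4$ the elements can be labelled $t,x,y,z$ so that: $\mathrm{Ad}_t$: $t\mapsto t,\ x\mapsto z,\ y\mapsto x,\ z\mapsto y$; $\mathrm{Ad}_x$: $t\mapsto y,\ x\mapsto x,\ y\mapsto z,\ z\mapsto t$; $\mathrm{Ad}_y$: $t\mapsto z,\ x\mapsto t,\ y\mapsto y,\ z\mapsto x$; $\mathrm{Ad}_z$: $t\mapsto x,\ x\mapsto y,\ y\mapsto t,\ z\mapsto z$. Differential calculus: $H=\mathbb{C}[G]$ is the algebra of complex functions on $G$, and $(R_af)(g)=f(ga)$. $\Omega^1(H)$ is the free left $H$-module with basis $\{e_a\}_{a\in\mathcal{C}}$, with right module structure $e_af=R_a(f)e_a$. Let $\Psi$ be the $H$-bimodule map on $\Omega^1(H)\otimes_H\Omega^1(H)$ with $\Psi(e_a\otimes_H e_b)=e_{aba^{-1}}\otimes_H e_a$. Then $\Omega^2(H)=(\Omega^1(H)\otimes_H\Omega^1(H))/\ker(\mathrm{id}-\Psi)$, with $\wedge$ the image in the quotient. Connections: a (spin) connection is a collection $\{A_a\}_{a\in\mathcal{C}}$ of 1-forms $A_a\in\Omega^1(H)$.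 With $e$ the identity of $G$, it is regular if $$\sum_{a,b\in\mathcal{C};\ ab=g}A_a\wedge A_b=0\qquad\forall g\in G,\ g\ne e,\ g\notin\mathcal{C}.$$ *)

(* Defs.v *)
From HB Require Import structures.
From mathcomp Require Import all_boot all_order all_fingroup all_algebra.
From mathcomp Require Import complex reals.

Set Implicit Arguments.
Unset Strict Implicit.
Unset Printing Implicit Defensive.

Import GRing.Theory.
Local Open Scope ring_scope.
Local Open Scope quotient_scope.

Section ConjClass.
Variable gT : finGroupType.

Record conj_class := ConjClass {
  class_set :> {set gT};
  class_setP : class_set \in classes [set: gT] }.

Variable C : conj_class.

Definition class_elt := {a : gT | a \in class_set C}.
HB.instance Definition _ := Finite.on class_elt.
HB.instance Definition _ := SubType.on class_elt.

Lemma ad_subproof (a b : class_elt) :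
  (val a * val b * (val a)^-1)%g \in class_set C.
Proof.
have conj_in (g h : gT) : h \in class_set C -> (h ^ g)%g \in class_set C.
  case/imsetP: (class_setP C) => c _ -> /imsetP[u _ ->].
  by rewrite -conjgM memJ_class ?inE.
by have := conj_in (val a)^-1%g (val b) (valP b); rewrite conjgE invgK mulgA.
Qed.

(* MathComp's [b ^ a] is [a^-1 b a]; here Ad_a(b) = a b a^-1. *)
Definition Ad (a b : class_elt) : class_elt := exist (fun c => c \in class_set C) _ (ad_subproof a b).

Definition cyclic_class : Prop :=
  (1 < #|C|)%N /\
  exists t : class_elt,
    (exists2 c : seq class_elt,
       fcycle (Ad t) c && uniq c & c =i predC1 t) /\
    bijective (fun a => Ad a t).

Definition Ad_table4 (t x y z : class_elt) : Prop :=
  [/\ [/\ Ad t t = t, Ad t x = z, Ad t y = x & Ad t z = y],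
      [/\ Ad x t = y, Ad x x = x, Ad x y = z & Ad x z = t],
      [/\ Ad y t = z, Ad y x = t, Ad y y = y & Ad y z = x]
    & [/\ Ad z t = x, Ad z x = y, Ad z y = t & Ad z z = z]].

End ConjClass.

Section Calculus.
Variables (R : realType) (gT : finGroupType) (C : conj_class gT).

Local Notation H := {ffun gT -> R[i]}.
Local Notation I := (class_elt C).

Definition Rtrans (a : gT) (f : H) : H := [ffun g => f (g * a)%g].

Lemma RtransD a : {morph Rtrans a : f g / f + g}.
Proof. by move=> f g; apply/ffunP=> h; rewrite !ffunE. Qed.

Lemma RtransM a : {morph Rtrans a : f g / f * g}.
Proof. by move=> f g; apply/ffunP=> h; rewrite !ffunE. Qed.

Lemma Rtrans0 a : Rtrans a 0 = 0.
Proof. by apply/ffunP=> h; rewrite !ffunE. Qed.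

Lemma Rtrans1 a : Rtrans a 1 = 1.
Proof. by apply/ffunP=> h; rewrite !ffunE. Qed.

Lemma Rtrans_comp a b f : Rtrans a (Rtrans b f) = Rtrans (a * b) f.
Proof. by apply/ffunP=> h; rewrite !ffunE mulgA. Qed.

(* The left H-module structure is the library's one on functions into the
   regular module H^o: the function w stands for \sum_a w a *: e_a. *)
Definition Omega1 := {ffun I -> H^o}.
HB.instance Definition _ := GRing.Lmodule.on Omega1.

Definition basis1 (a : I) : Omega1 := [ffun b => (b == a)%:R].

Definition rmul1 (w : Omega1) (f : H) : Omega1 :=
  [ffun a => (w a : H) * Rtrans (val a) f].

Lemma Omega1E (w : Omega1) : w = \sum_a (w a : H) *: basis1 a.
Proof.
apply/ffunP=> b; rewrite sum_ffunE (bigD1 b) //= big1 => [|a nab].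
  by rewrite !ffunE eqxx addr0 /GRing.scale /= mulr1.
by rewrite !ffunE eq_sym (negPf nab) scaler0.
Qed.

Lemma rmul1_basis a f : rmul1 (basis1 a) f = Rtrans (val a) f *: basis1 a.
Proof.
apply/ffunP=> b; rewrite !ffunE /GRing.scale /=.
by case: eqP => [->|_]; rewrite ?mul1r ?mulr1 ?mul0r ?mulr0.
Qed.

Lemma rmul1Z f w g : rmul1 (f *: w) g = f *: rmul1 w g.
Proof. by apply/ffunP=> b; rewrite !ffunE /GRing.scale /= mulrA. Qed.

Lemma rmul1M w f g : rmul1 w (f * g) = rmul1 (rmul1 w f) g.
Proof. by apply/ffunP=> b; rewrite !ffunE RtransM mulrA. Qed.

Lemma rmul1D w v f : rmul1 (w + v) f = rmul1 w f + rmul1 v f.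
Proof. by apply/ffunP=> b; rewrite !ffunE mulrDl. Qed.

Lemma rmul1_1 w : rmul1 w 1 = w.
Proof. by apply/ffunP=> b; rewrite !ffunE Rtrans1 mulr1. Qed.

(* Omega1 (x)_H Omega1.  MathComp has no tensor product of bimodules.  Since
   Omega1 is free on the left, the tensor product is free on the left with
   basis e_a (x) e_b, and f e_a (x) g e_b = f R_a(g) (e_a (x) e_b); the
   universal property is proved in [tens_universal] below. *)
Definition Tens := {ffun I * I -> H^o}.
HB.instance Definition _ := GRing.Lmodule.on Tens.

Definition tens (w v : Omega1) : Tens :=
  [ffun p => (w p.1 : H) * Rtrans (val p.1) (v p.2)].

Definition rmulT (T : Tens) (f : H) : Tens :=
  [ffun p => (T p : H) * Rtrans (val p.1 * val p.2)%g f].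

Lemma tensDl w w' v : tens (w + w') v = tens w v + tens w' v.
Proof. by apply/ffunP=> p; rewrite !ffunE mulrDl. Qed.

Lemma tensDr w v v' : tens w (v + v') = tens w v + tens w v'.
Proof. by apply/ffunP=> p; rewrite !ffunE RtransD mulrDr. Qed.

Lemma tens_balanced w f v : tens (rmul1 w f) v = tens w (f *: v).
Proof. by apply/ffunP=> p; rewrite !ffunE RtransM mulrA. Qed.

Lemma tensZl f w v : tens (f *: w) v = f *: tens w v.
Proof. by apply/ffunP=> p; rewrite !ffunE /GRing.scale /= mulrA. Qed.

Lemma tensZr w v f : tens w (rmul1 v f) = rmulT (tens w v) f.
Proof. by apply/ffunP=> p; rewrite !ffunE RtransM Rtrans_comp mulrA. Qed.

Lemma tens_basisE a b p : tens (basis1 a) (basis1 b) p = (p == (a, b))%:R.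
Proof.
case: p => c d; rewrite !ffunE /= xpair_eqE.
case: eqP => _; rewrite ?mul0r // mul1r.
by case: eqP => _; rewrite ?Rtrans1 ?Rtrans0.
Qed.

Lemma TensE (T : Tens) :
  T = \sum_p (T p : H) *: tens (basis1 p.1) (basis1 p.2).
Proof.
apply/ffunP=> q; rewrite sum_ffunE (bigD1 q) //= big1 => [|p npq].
  by rewrite ffunE tens_basisE -surjective_pairing eqxx addr0
             /GRing.scale /= mulr1.
by rewrite ffunE tens_basisE -surjective_pairing eq_sym (negPf npq) scaler0.
Qed.

Lemma tens_universal (V : zmodType) (beta : Omega1 -> Omega1 -> V) :
    (forall w w' v, beta (w + w') v = beta w v + beta w' v) ->
    (forall w v v', beta w (v + v') = beta w v + beta w v') ->
    (forall w f v, beta (rmul1 w f) v = beta w (f *: v)) ->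
  exists2 phi : {additive Tens -> V},
    forall w v, phi (tens w v) = beta w v &
    forall psi : {additive Tens -> V},
      (forall w v, psi (tens w v) = beta w v) -> psi =1 phi.
Proof.
move=> bDl bDr bal.
have b0 v : beta 0 v = 0 by apply: (addrI (beta 0 v)); rewrite -bDl !addr0.
have bN w v : beta (- w) v = - beta w v.
  by apply: (addrI (beta w v)); rewrite -bDl !subrr b0.
pose phi0 (T : Tens) : V := \sum_p beta ((T p : H) *: basis1 p.1) (basis1 p.2).
have phi_zmod : zmod_morphism phi0.
  move=> T U; rewrite /phi0 -sumrB; apply: eq_bigr => p _.
  by rewrite !ffunE scalerBl bDl bN.
pose phi : {additive Tens -> V} :=
  HB.pack phi0 (GRing.isZmodMorphism.Build _ _ phi0 phi_zmod).
have b0r w : beta w 0 = 0 by apply: (addrI (beta w 0)); rewrite -bDr !addr0.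
have phi0E w v : phi0 (tens w v) = beta w v.
  rewrite {2}(Omega1E w) {2}(Omega1E v).
  rewrite (big_morph (beta^~ _) (fun x y => bDl x y _) (b0 _)).
  have -> : phi0 (tens w v) =
      \sum_a \sum_b beta (((tens w v) (a, b) : H) *: basis1 a) (basis1 b).
    rewrite (pair_bigA _ (fun a b : I =>
      beta ((tens w v (a, b) : H) *: basis1 a) (basis1 b))) /phi0.
    by apply: eq_bigr => -[].
  apply: eq_bigr => a _.
  rewrite (big_morph (beta _) (fun x y => bDr _ x y) (b0r _)).
  apply: eq_bigr => b _; rewrite ffunE /= -bal; congr (beta _ _).
  by rewrite rmul1Z rmul1_basis scalerA.
exists phi => [//|psi psiE T].
rewrite {1}(TensE T) raddf_sum; apply: eq_bigr => p _.
by rewrite -tensZl psiE.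
Qed.

(* Psi, extended left H-linearly from the basis; [braidZr] below is its right
   H-linearity. *)
Definition braid (T : Tens) : Tens :=
  \sum_p (T p : H) *: tens (basis1 (Ad p.1 p.2)) (basis1 p.1).

Lemma braid_basis a b :
  braid (tens (basis1 a) (basis1 b)) = tens (basis1 (Ad a b)) (basis1 a).
Proof.
rewrite /braid (bigD1 (a, b)) //= big1 => [|p npq].
  by rewrite tens_basisE eqxx scale1r addr0.
by rewrite tens_basisE (negPf npq) scale0r.
Qed.

Lemma braidD : {morph braid : T U / T + U}.
Proof.
move=> T U; rewrite /braid -big_split /=.
by apply: eq_bigr => p _; rewrite ffunE scalerDl.
Qed.

Lemma braidZ f T : braid (f *: T) = f *: braid T.
Proof.
rewrite /braid scaler_sumr; apply: eq_bigr => p _.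
by rewrite ffunE scalerA.
Qed.

Lemma rmulTD T U f : rmulT (T + U) f = rmulT T f + rmulT U f.
Proof. by apply/ffunP=> b; rewrite !ffunE mulrDl. Qed.

Lemma braidZr T f : braid (rmulT T f) = rmulT (braid T) f.
Proof.
have rsum := big_morph (fun U => rmulT U f) (fun U U' => rmulTD U U' f)
  (id1 := 0) (id2 := 0) _.
rewrite /braid rsum; last by apply/ffunP=> p; rewrite !ffunE mul0r.
apply: eq_bigr => p _; apply/ffunP=> q.
have zE (g : H) (U : Tens) : (g *: U) q = g * (U q : H) by rewrite ffunE.
have rE (U : Tens) r : rmulT U f r = (U r : H) * Rtrans (val r.1 * val r.2)%g f.
  by rewrite ffunE.
rewrite zE !rE zE tens_basisE.
case: eqP => [->|_]; rewrite ?mulr0 ?mul0r //= !mulr1.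
by rewrite mulgKV.
Qed.

Definition ker_id_braid : {pred Tens} := [pred T | T - braid T == 0].

Lemma ker_id_braid_zmod : zmod_closed ker_id_braid.
Proof.
have bN T : braid (- T) = - braid T by rewrite -scaleN1r braidZ scaleN1r.
split=> [|T U]; rewrite !inE.
  by rewrite -(scale0r 0) braidZ !scale0r subr0.
move=> /eqP hT /eqP hU; rewrite braidD bN.
by rewrite opprD addrACA -opprD hT hU subr0.
Qed.
HB.instance Definition _ :=
  GRing.isZmodClosed.Build Tens ker_id_braid ker_id_braid_zmod.

Lemma ker_id_braid_bimod f T : T \in ker_id_braid ->
  (f *: T \in ker_id_braid) /\ (rmulT T f \in ker_id_braid).
Proof.
have kerP (U : Tens) : (U \in ker_id_braid) = (U == braid U).
  by rewrite inE subr_eq0.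
move=> kT; have bT : braid T = T by move: kT; rewrite kerP => /eqP.
by split; rewrite kerP; apply/eqP; [rewrite braidZ bT | rewrite braidZr bT].
Qed.

Definition Omega2 := Quotient.quot ker_id_braid.
HB.instance Definition _ := GRing.Zmodule.on Omega2.

Definition wedge (w v : Omega1) : Omega2 := \pi_Omega2 (tens w v).

Definition connection := I -> Omega1.

Definition regular (A : connection) : Prop :=
  forall g : gT, g != 1%g -> g \notin class_set C ->
    \sum_(p : I * I | (val p.1 * val p.2)%g == g) wedge (A p.1) (A p.2) = 0.

End Calculus.

Notation "w ∧ v" := (wedge w v) (at level 40, left associativity) : ring_scope.

(* Main.v *)
(* Let u run over the class.  The product ab of two elements of the class acts
   on it as Ad_u^2 for exactly one u, its unique fixed point; since Ad_u is a
   3-cycle, ab is neither e nor in the class, and products with different u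
   differ.  The twelve products of distinct elements fall into four triples of
   equal ones, one for each u, and uu also has fixed point u.  By conjugation,
   either every square equals the triple with the same fixed point or none
   does; these are the two systems. *)
Require Import Defs.
From HB Require Import structures.
From mathcomp Require Import all_boot all_order all_fingroup all_algebra.
From mathcomp Require Import complex reals.

Set Implicit Arguments.
Unset Strict Implicit.
Unset Printing Implicit Defensive.

Local Open Scope ring_scope.

Import GRing.Theory.

Section AdTheory.
Variables (gT : finGroupType) (C : conj_class gT).
Implicit Types a b c d u : class_elt C.

(** The identity $ab = \mathrm{Ad}_a(b)\,a$ is the source of every coincidence between products of
    distinct elements used below. *)
Lemma val_AdM a b : (val (Ad a b) * val a = val a * val b)%g.
Proof. by rewrite /= mulgKV. Qed.

Lemma val_Ad_comp a b u :
  val (Ad a (Ad b u)) = (val u ^ (val a * val b)^-1)%g.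
Proof. by rewrite /= conjgE invgK invMg !mulgA. Qed.

Lemma Ad_mul_eq a b c d u : (val a * val b = val c * val d)%g ->
  Ad a (Ad b u) = Ad c (Ad d u).
Proof. by move=> e; apply: val_inj; rewrite !val_Ad_comp e. Qed.

(** Conjugation by a product depends only on its value, so a single point [u] moved differently
    separates two products. The converse fails when a central element intervenes, hence the later
    case distinction. *)
Lemma mul_neq u a b c d : Ad a (Ad b u) != Ad c (Ad d u) ->
  (val a * val b != val c * val d)%g.
Proof. by apply: contraNneq => /Ad_mul_eq ->. Qed.

Lemma mul_neq1 u a b : Ad a (Ad b u) != u -> (val a * val b != 1)%g.
Proof.
by apply: contraNneq => e; apply/eqP/val_inj; rewrite val_Ad_comp e invg1 conjg1.
Qed.

Lemma mul_neq_class u a b c : Ad a (Ad b u) != Ad c u ->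
  (val a * val b != val c)%g.
Proof.
apply: contraNneq => e; apply/eqP/val_inj.
by rewrite val_Ad_comp e /= conjgE invgK mulgA.
Qed.

Lemma Ad_mul_conj u a b c d : (val a * val b = val c * val d)%g ->
  (val (Ad u a) * val (Ad u b) = val (Ad u c) * val (Ad u d))%g.
Proof.
have AdJ e : val (Ad u e) = (val e ^ (val u)^-1)%g by rewrite /= conjgE invgK mulgA.
by move=> e; rewrite !AdJ -!conjMg e.
Qed.

End AdTheory.

Lemma uniq_map_inj_in (T1 T2 : eqType) (f : T1 -> T2) (s : seq T1) :
  uniq (map f s) -> {in s &, injective f}.
Proof.
elim: s => //= u s IHs /andP[fus /IHs injs] v w; rewrite !inE.
case/predU1P=> [->|vs] /predU1P[->|ws] //; last exact: injs.
  by move=> e; rewrite e map_f in fus.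
by move=> e; rewrite -e map_f in fus.
Qed.

(** [L] tabulates the multiplication on the class: each entry is a product value with the pairs
    attaining it. As the pairs are partitioned by value, regularity becomes one equation per
    entry. *)
Lemma regular_blocks (R : realType) (gT : finGroupType) (C : conj_class gT)
    (L : seq (gT * seq (class_elt C * class_elt C))) (A : connection R C) :
    uniq [seq B.1 | B <- L] ->
    all (fun B => (B.1 != 1%g) && (B.1 \notin class_set C)) L ->
    all (fun B => all (fun p => (val p.1 * val p.2)%g == B.1) B.2) L ->
    size (flatten [seq B.2 | B <- L]) = #|{: class_elt C * class_elt C}| ->
    (forall p, p \in flatten [seq B.2 | B <- L]) ->
  regular A <-> all (fun B => \sum_(p <- B.2) A p.1 ∧ A p.2 == 0) L.
Proof.
move=> Lq /allP LC /allP Lm Lsz Lf.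
(* A list that covers a finite type and has its length cannot repeat an element. *)
have Lu : uniq (flatten [seq B.2 | B <- L]).
  by apply/card_uniqP; rewrite Lsz; apply: eq_card.
(* All pairs of a block share the product [B.1], so a block enters the sum at [g] wholly or not at
   all. *)
have sumE (g : gT) :
    \sum_(p | (val p.1 * val p.2)%g == g) A p.1 ∧ A p.2
      = \sum_(B <- L | B.1 == g) \sum_(p <- B.2) A p.1 ∧ A p.2.
  transitivity (\sum_(p <- flatten [seq B.2 | B <- L]
                        | (val p.1 * val p.2)%g == g) A p.1 ∧ A p.2).
    by rewrite -big_filter -[RHS]big_filter; apply/perm_big/uniq_perm;
      rewrite ?filter_uniq ?index_enum_uniq // => p;
      rewrite !mem_filter Lf mem_index_enum.
  rewrite big_flatten big_map [RHS]big_mkcond /=.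
  rewrite big_seq [RHS]big_seq; apply: eq_bigr => B /Lm /allP Bm.
  rewrite big_mkcond big_seq; case: eqP => [<-|ne].
    by rewrite [RHS]big_seq; apply: eq_bigr => p /Bm ->.
  by apply: big1 => p /Bm /eqP ->; case: eqP.
split=> [regA|/allP L0].
  apply/allP=> B BL; have /andP[B1 BC] := LC _ BL.
  move: (regA _ B1 BC); rewrite sumE big_mkcond (bigD1_seq B) ?(map_uniq Lq) //= eqxx.
  rewrite [X in _ + X]big_seq_cond [X in _ + X]big1 ?addr0 => [->//|B' /andP[B'L neB]].
  by case: eqP => // /(uniq_map_inj_in Lq) e; rewrite e ?eqxx in neB.
move=> g _ _; rewrite sumE big_seq_cond big1 // => B /andP[BL _].
exact/eqP/L0.
Qed.

Theorem proposition3p5 (R : realType) (gT : finGroupType) (C : conj_class gT)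
    (t x y z : class_elt C)
    (C_cyclic : cyclic_class C)
    (C_card : #|C| = 4%N)
    (C_eq : [set: class_elt C] = [set t; x; y; z])
    (C_table : Ad_table4 t x y z) :
  (forall A : connection R C,
     regular A <->
     [/\ A t ∧ A t + A x ∧ A y + A y ∧ A z + A z ∧ A x = 0,
         A t ∧ A x + A x ∧ A z + A y ∧ A y + A z ∧ A t = 0,
         A t ∧ A y + A x ∧ A t + A y ∧ A x + A z ∧ A z = 0
       & A t ∧ A z + A x ∧ A x + A y ∧ A t + A z ∧ A y = 0])
  \/
  (forall A : connection R C,
     regular A <->
     [/\ [/\ A t ∧ A t = 0, A x ∧ A x = 0, A y ∧ A y = 0 & A z ∧ A z = 0],
         A t ∧ A x + A x ∧ A z + A z ∧ A t = 0,
         A t ∧ A y + A x ∧ A t + A y ∧ A x = 0,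
         A t ∧ A z + A y ∧ A t + A z ∧ A y = 0
       & A x ∧ A y + A y ∧ A z + A z ∧ A x = 0]).
Proof.
have C_case u : [|| u == t, u == x, u == y | u == z].
  by have := in_setT u; rewrite C_eq !inE -!orbA.
have card_elt : #|{: class_elt C}| = 4%N by rewrite card_sig -C_card.
have uniq4 : uniq [:: t; x; y; z].
  by apply/card_uniqP; rewrite -[RHS]card_elt; apply: eq_card => u; rewrite !inE C_case.
have card16 : 16%N = #|{: class_elt C * class_elt C}|.
  by rewrite card_prod card_elt.
have pairs16 (s : seq (class_elt C * class_elt C)) :
    all (fun a => all (fun b => (a, b) \in s) [:: t; x; y; z]) [:: t; x; y; z] ->
    forall p, p \in s.
  move=> /allP sP [a b]; have /sP/allP : a \in [:: t; x; y; z] by rewrite !inE.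
  by apply; rewrite !inE.
have neq : (t != x) * (t != y) * (t != z) * (x != y) * (x != z) * (y != z)
    * (x != t) * (y != t) * (z != t) * (y != x) * (z != x) * (z != y).
  move: uniq4; rewrite /= !inE !negb_or => /and4P[/and3P[n1 n2 n3] /andP[n4 n5] n6 _].
  by do !split; rewrite // eq_sym.
have [[tt tx ty tz] [xt xx xy xz] [yt yx yy yz] [zt zx zy zz]] := C_table.
have AdE := (tt, tx, ty, tz, (xt, xx, xy, xz), (yt, yx, yy, yz), (zt, zx, zy, zz)).
(* Iterating [val_AdM] permutes each triple cyclically, so one or two uses reach the chosen
   representative: $xy$, $tx$, $ty$, $tz$, with fixed points $t$, $y$, $z$, $x$. *)
have mulE : ((val y * val z = val x * val y)%g * (val z * val x = val x * val y)%g
    * (val x * val z = val t * val x)%g * (val z * val t = val t * val x)%g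
    * (val x * val t = val t * val y)%g * (val y * val x = val t * val y)%g
    * (val y * val t = val t * val z)%g * (val z * val y = val t * val z)%g).
  have M := @val_AdM _ C.
  by do !split; first [by rewrite -M AdE | by rewrite -M AdE -M AdE].
have prod_neq a b c d :
    (Ad a (Ad b t) != Ad c (Ad d t)) || (Ad a (Ad b x) != Ad c (Ad d x)) ->
    (val a * val b != val c * val d)%g.
  by case/orP; apply: mul_neq.
have prod_out (a b : class_elt C) :
    ((val a * val b)%g != 1%g) && ((val a * val b)%g \notin class_set C).
  apply/andP; split.
    (* The product fixes only one point of the class, so it moves [t] or [x]. *)
    have : (Ad a (Ad b t) != t) || (Ad a (Ad b x) != x).
      by case/or4P: (C_case a) => /eqP ->; case/or4P: (C_case b) => /eqP ->;
        rewrite !AdE ?neq ?orbT.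
    by case/orP; apply: mul_neq1.
  apply/negP=> abC.
  have [c cE] : exists c : class_elt C, val c = (val a * val b)%g.
    by exists (exist (fun c => c \in class_set C) _ abC).
  (* The square of one [Ad u] agrees with any [Ad c] at exactly one point, so a test point separates
     them. *)
  have : [|| Ad a (Ad b t) != Ad c t, Ad a (Ad b x) != Ad c x
           | Ad a (Ad b y) != Ad c y].
    by case/or4P: (C_case a) => /eqP ->; case/or4P: (C_case b) => /eqP ->;
      case/or4P: (C_case c) => /eqP ->; rewrite !AdE ?neq ?orbT.
  by case/or3P=> /mul_neq_class; rewrite cE eqxx.
(* Both $tt$ and $xy$ act with fixed point $t$; whether they coincide depends on the group. *)
have [sq|sq] := eqVneq (val t * val t)%g (val x * val y)%g; [left|right] => A.
  have sqs : ((val y * val y = val t * val x)%g * (val z * val z = val t * val y)%g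
      * (val x * val x = val t * val z)%g).
    (* Conjugation by $x$, $y$, $z$ sends $t$ to $y$, $z$, $x$, and [mulE] normalises the right-hand
       sides. *)
    have J u := Ad_mul_conj u sq.
    by have := (J x, J y, J z); rewrite !AdE !mulE => -[[-> ->] ->].
  rewrite (@regular_blocks _ _ _
    [:: ((val x * val y)%g, [:: (t, t); (x, y); (y, z); (z, x)]);
        ((val t * val x)%g, [:: (t, x); (x, z); (y, y); (z, t)]);
        ((val t * val y)%g, [:: (t, y); (x, t); (y, x); (z, z)]);
        ((val t * val z)%g, [:: (t, z); (x, x); (y, t); (z, y)])]).
  - rewrite /= !big_cons !big_nil /= !addr0 !addrA.
    by split=> [/and5P[/eqP-> /eqP-> /eqP-> /eqP-> _]|[-> -> -> ->]]; rewrite ?eqxx.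
  - by rewrite /= !inE !negb_or !andbT; do !(apply/andP; split);
    apply: prod_neq; rewrite !AdE ?neq ?orbT.
  - by rewrite /= !prod_out.
  - by rewrite /= !mulE ?sq ?sqs !eqxx.
  - exact: card16.
  - by apply: pairs16; rewrite /= !inE !eqxx !orbT.
have sqs : ((val y * val y != val t * val x)%g * (val z * val z != val t * val y)%g
    * (val x * val x != val t * val z)%g).
  (* Conversely, an equality for $y$, $z$ or $x$ is conjugated back to $tt = xy$ by $z$, $x$ or $y$,
     which sends that element to $t$. *)
  do !split; apply: contraNneq sq => /Ad_mul_conj.
  - by move/(_ z); rewrite !AdE ?mulE => ->.
  - by move/(_ x); rewrite !AdE ?mulE => ->.
  - by move/(_ y); rewrite !AdE ?mulE => ->.
rewrite (@regular_blocks _ _ _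
    [:: ((val t * val t)%g, [:: (t, t)]); ((val x * val x)%g, [:: (x, x)]);
        ((val y * val y)%g, [:: (y, y)]); ((val z * val z)%g, [:: (z, z)]);
        ((val t * val x)%g, [:: (t, x); (x, z); (z, t)]);
        ((val t * val y)%g, [:: (t, y); (x, t); (y, x)]);
        ((val t * val z)%g, [:: (t, z); (y, t); (z, y)]);
        ((val x * val y)%g, [:: (x, y); (y, z); (z, x)])]).
- rewrite /= !big_cons !big_nil /= !addr0 !addrA.
  split=> [/and5P[/eqP-> /eqP-> /eqP-> /eqP-> /and5P[/eqP-> /eqP-> /eqP-> /eqP-> _]] //|].
  by case=> -[-> -> -> ->] -> -> -> ->; rewrite !eqxx.
(* A square and the triple with its fixed point act alike, so [sq] and [sqs] separate them; the
   other values differ by their action. *)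
- by rewrite /= !inE !negb_or !andbT; do !(apply/andP; split); rewrite ?sq ?sqs //;
  apply: prod_neq; rewrite !AdE ?neq ?orbT.
- by rewrite /= !prod_out.
- by rewrite /= !mulE !eqxx.
- exact: card16.
- by apply: pairs16; rewrite /= !inE !eqxx !orbT.
Qed.
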